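(* Let $d\ge2$ be a constant integer. Then every randomized statistical query (SQ) distance approximation algorithm for halfspaces under the standard Gaussian $\mathcal{N}(0,I)$ on $\mathbb{R}^d$ with success probability at least $0.51$ requires $(1/\epsilon)^{\Omega(d)}$ queries to $\mathrm{STAT}(\epsilon^{\Omega(d)})$, where $\Omega(d)$ denotes $cd$ for an absolute constant $c>0$.
   Context: $\mathcal{H}$ is the class of halfspaces over $\mathbb{R}^d$ viewed as $\{\pm1\}$-valued functions $x\mapsto\mathrm{sign}(\langle w,x\rangle+\theta)$. For $f:\mathbb{R}^d\to\{\pm1\}$, $\mathrm{dist}_{\mathcal{N}(0,I)}(f,\mathcal{H})=\inf_{h\in\mathcal{H}}\Pr_{x\sim\mathcal{N}(0,I)}[f(x)\ne h(x)]$. Given tolerance $\tau>0$ and a query $q:\mathbb{R}^d\times[-1,1]\to[-1,1]$, the oracle $\mathrm{STAT}(\tau)$ returns some $v$ with $|\mathbb{E}_{x\sim\mathcal{N}(0,I)}[q(x,f(x))]-v|\le\tau$ (the answer may be adversarial within this tolerance). An SQ algorithm accesses its input $f$ only via such an oracle. A randomized SQ distance approximation algorithm for halfspaces under $\mathcal{N}(0,I)$, given $\epsilon$ and oracle access to $f$, outputs $\widehat\alpha$ with $|\mathrm{dist}_{\mathcal{N}(0,I)}(f,\mathcal{H})-\widehat\alpha|\le\epsilon$ with the stated success probability. *)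

(* Defs.v *)
From HB Require Import structures.
From mathcomp Require Import all_boot all_order all_algebra.
From mathcomp Require Import all_classical all_reals all_analysis.

Set Implicit Arguments.
Unset Strict Implicit.
Unset Printing Implicit Defensive.

Import Order.TTheory GRing.Theory Num.Theory.

Local Open Scope classical_set_scope.
Local Open Scope ring_scope.

(* R^d is [d.-tuple (measurableTypeR R)], with the library's product of the
   Borel sigma-algebras of the coordinates. *)
Notation vec R d := (d.-tuple (measurableTypeR R)).

Section gaussian.
Context (R : realType).

Definition vec_cons (n : nat) (p : measurableTypeR R * vec R n) : vec R n.+1 :=
  [the n.+1.-tuple (measurableTypeR R) of p.1 :: p.2].

Lemma measurable_vec_cons (n : nat) : measurable_fun setT (@vec_cons n).
Proof. exact: measurable_cons. Qed.

HB.instance Definition _ (n : nat) :=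
  isMeasurableFun.Build _ _ _ _ (@vec_cons n) (@measurable_vec_cons n).

(* N(0, I) is the law of d independent standard normal coordinates. *)
Fixpoint gaussian (d : nat) : probability (vec R d) R :=
  match d with
  | 0 => dirac [tuple]
  | n.+1 => distribution (normal_prob 0 1 \x gaussian n)%E (@vec_cons n)
  end.

End gaussian.

Section halfspaces.
Context (R : realType) (d : nat).

(* sign(0) = 1, so that halfspaces are {-1, 1}-valued, unlike with [Num.sg]. *)
Definition sign (t : R) : R := if 0 <= t then 1 else -1.

Definition halfspace (w : vec R d) (theta : R) : vec R d -> R :=
  fun x => sign (\sum_(i < d) tnth w i * tnth x i + theta).

Definition halfspaces : set (vec R d -> R) :=
  [set h | exists w theta, h = halfspace w theta].

Definition disagreement (f h : vec R d -> R) : R :=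
  fine (gaussian R d [set x | f x != h x]).

Definition dist_halfspaces (f : vec R d -> R) : R :=
  inf [set disagreement f h | h in halfspaces].

(* Measurability is implicit in talking about Pr[f(x) <> h(x)] and
   E[q(x, f(x))]. *)
Definition sign_valued (f : vec R d -> R) : Prop :=
  measurable_fun setT f /\ forall x, f x = 1 \/ f x = -1.

End halfspaces.

Section statistical_queries.
Context (R : realType) (d : nat).

(* A query R^d * [-1, 1] -> [-1, 1]; its values at labels outside [-1, 1] are
   unconstrained and never used. *)
Record sq_query := SQQuery {
  query_fun :> vec R d -> R -> R;
  query_measurable : measurable_fun
    ([set: vec R d] `*` [set` `[(-1 : R), 1]])
    (fun p : vec R d * measurableTypeR R => query_fun p.1 p.2);
  query_range : forall x y, -1 <= y <= 1 -> -1 <= query_fun x y <= 1 }.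

Definition query_mean (f : vec R d -> R) (q : sq_query) : R :=
  \int[gaussian R d]_x q x (f x).

(* An adversarial oracle may answer according to the queries asked so far
   (first argument, oldest first); its own past answers are determined by
   them. *)
Definition oracle := seq sq_query -> sq_query -> R.

Definition STAT (tau : R) (f : vec R d -> R) (O : oracle) : Prop :=
  forall h q, `|query_mean f q - O h q| <= tau.

(* A deterministic adaptive SQ algorithm: stop with an output, or ask a query
   and continue according to the answer. *)
Inductive sq_alg :=
| Output of R
| Ask of sq_query & (R -> sq_alg).

(* The output together with all the queries asked. *)
Fixpoint sq_exec (O : oracle) (h : seq sq_query) (A : sq_alg) :
    R * seq sq_query :=
  match A with
  | Output a => (a, h)
  | Ask q k => sq_exec O (rcons h q) (k (O h q))
  end.

Definition sq_output (O : oracle) (A : sq_alg) : R := (sq_exec O [::] A).1.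

Definition sq_cost (O : oracle) (A : sq_alg) : nat := size (sq_exec O [::] A).2.

End statistical_queries.

Section randomized_algorithms.
Context (R : realType) (d : nat).
Context (disp : measure_display) (Omega : measurableType disp).

(* A randomized SQ algorithm is a family [A] of deterministic ones indexed by
   the random seed, drawn from [P].  The good seeds are asked to contain an
   event of probability at least [p], because the set of good seeds against an
   arbitrary oracle need not be measurable; when it is, this says that its
   probability is at least [p]. *)
Definition sq_dist_approx (P : probability Omega R) (A : Omega -> sq_alg R d)
    (tau eps p : R) : Prop :=
  forall f, sign_valued f -> forall O, STAT tau f O ->
  exists E : set Omega, [/\ measurable E, (p%:E <= P E)%E &
    E `<=` [set s | `|dist_halfspaces f - sq_output O (A s)| <= eps]].

Definition sq_cost_le (A : Omega -> sq_alg R d) (tau : R) (m : nat) : Prop :=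
  forall f, sign_valued f -> forall O, STAT tau f O ->
  forall s, (sq_cost O (A s) <= m)%N.

End randomized_algorithms.

(* Main.v *)
Require Import Defs.
From HB Require Import structures.
From mathcomp Require Import all_boot all_order all_algebra.
From mathcomp Require Import all_classical all_reals all_analysis.
From mathcomp Require Import measurable_realfun ring lra.

Set Implicit Arguments.
Unset Strict Implicit.
Unset Printing Implicit Defensive.

Import Order.TTheory GRing.Theory Num.Theory.

Local Open Scope classical_set_scope.
Local Open Scope ring_scope.

(* Let [wave u = (-1) ^ floor u].  The hard functions are the plane waves
   [wave <w, x>] whose frequency vector [w = nu * (..., j_1, M, j_0, M)] is
   given by digits [j_i < M], one for each pair of coordinates.  All means are
   controlled by one estimate: translating a bounded function by [h] changes its
   mean under N(0, 1) by O(h).  If two digit vectors differ in a pair, then some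
   translation of length O(1 / nu) in the plane of that pair flips the sign of
   one wave and preserves the other, so each differing pair contributes a factor
   O(1 / nu) to the correlation.  As there are [M] choices for a digit, the sum
   of the correlations of one wave with all the others is at most [9 ^ (d/2)]
   as soon as [nu >= M], and by Cauchy-Schwarz a query of tolerance [tau] can
   distinguish at most [9 ^ (d/2) / tau ^ 2] of the [M ^ (d/2)] waves from a
   random coin.

   On the other hand the distance to halfspaces depends on the frequency: every
   halfspace has correlation at most [8 / (nu M)] with a wave, while one of the
   halfspaces [<w, x> >= 0] and [<w, x> <= 1/2], which overlap exactly in a slab
   where the wave is 1, has correlation at least [kappa_d / (nu M)].  Taking
   [M ^ 2] of order [1 / eps], the families with [nu = M] and with
   [nu = Lambda M] are more than [2 eps] apart, and an algorithm that is told
   the answers for a random coin cannot be right on both. *)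

(** * Means of bounded measurable functions *)

Section bounded_measurable.
Context (R : realType).

(** Boundedness makes integrability under any probability automatic, so manipulating means only
    requires closure of this class under the operations below. *)
Definition bmeas (disp : measure_display) (T : measurableType disp)
    (f : T -> R) : Prop :=
  measurable_fun setT f /\ exists B, forall x, `|f x| <= B.

Context (disp : measure_display) (T : measurableType disp).
Implicit Types f g : T -> R.

Lemma bmeas_cst (r : R) : bmeas (fun _ : T => r).
Proof. by split=> //; exists `|r|. Qed.

Lemma bmeasD f g : bmeas f -> bmeas g -> bmeas (fun x => f x + g x).
Proof.
move=> [mf [B fB]] [mg [C gC]]; split; first exact: measurable_funD.
by exists (B + C) => x; apply: le_trans (ler_normD _ _) _; apply: lerD.
Qed.

Lemma bmeasM f g : bmeas f -> bmeas g -> bmeas (fun x => f x * g x).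
Proof.
move=> [mf [B fB]] [mg [C gC]]; split; first exact: measurable_funM.
by exists (B * C) => x; rewrite normrM; apply: ler_pM.
Qed.

Lemma bmeasZ (r : R) f : bmeas f -> bmeas (fun x => r * f x).
Proof. by apply: bmeasM; exact: bmeas_cst. Qed.

Lemma bmeasN f : bmeas f -> bmeas (fun x => - f x).
Proof.
move=> /(bmeasZ (-1)); congr bmeas.
by apply/funext => x; rewrite mulN1r.
Qed.

Lemma bmeasB f g : bmeas f -> bmeas g -> bmeas (fun x => f x - g x).
Proof. by move=> bf bg; apply: bmeasD => //; exact: bmeasN. Qed.

Lemma bmeas_norm f : bmeas f -> bmeas (fun x => `|f x|).
Proof.
move=> [mf [B fB]]; split; first exact: measurableT_comp.
by exists B => x; rewrite normr_id.
Qed.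

Lemma bmeas_sum (I : Type) (r : seq I) (F : I -> T -> R) :
  (forall i, bmeas (F i)) -> bmeas (fun x => \sum_(i <- r) F i x).
Proof.
move=> bF; elim: r => [|i r IH].
  by under eq_fun do rewrite big_nil; exact: bmeas_cst.
by under eq_fun do rewrite big_cons; exact: bmeasD.
Qed.

Lemma bmeas_indic (A : set T) : measurable A -> bmeas (\1_A : T -> R).
Proof.
move=> mA; split; first exact: measurable_indic.
by exists 1 => x; rewrite indicE; case: (_ \in _); rewrite ?normr1 ?normr0.
Qed.

Lemma bmeas_comp (disp' : measure_display) (T' : measurableType disp')
    (f : T' -> R) (g : T -> T') :
  measurable_fun setT g -> bmeas f -> bmeas (fun x => f (g x)).
Proof.
move=> mg [mf [B fB]]; split; first exact: measurableT_comp.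
by exists B.
Qed.

Variable P : probability T R.

Lemma bmeas_integrable f : bmeas f -> P.-integrable setT (EFin \o f).
Proof.
move=> [mf [B fB]]; apply: measurable_bounded_integrable => //.
  exact: le_lt_trans (probability_le1 P measurableT) (ltry 1).
exists B; split; first exact: num_real.
by move=> y By x _; exact: le_trans (fB x) (ltW By).
Qed.

Lemma mean_cst (r : R) : \int[P]_x r = r.
Proof. by rewrite Rintegral_cst//= probability_setT mulr1. Qed.

Lemma meanD f g : bmeas f -> bmeas g ->
  \int[P]_x (f x + g x) = \int[P]_x f x + \int[P]_x g x.
Proof. by move=> bf bg; rewrite RintegralD//; exact: bmeas_integrable. Qed.

Lemma meanB f g : bmeas f -> bmeas g ->
  \int[P]_x (f x - g x) = \int[P]_x f x - \int[P]_x g x.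
Proof. by move=> bf bg; rewrite RintegralB//; exact: bmeas_integrable. Qed.

Lemma meanZ (r : R) f : bmeas f -> \int[P]_x (r * f x) = r * \int[P]_x f x.
Proof. by move=> bf; rewrite RintegralZl//; exact: bmeas_integrable. Qed.

Lemma meanN f : bmeas f -> \int[P]_x (- f x) = - \int[P]_x f x.
Proof.
move=> bf; rewrite -mulN1r -meanZ//.
by apply: eq_Rintegral => x _; rewrite mulN1r.
Qed.

Lemma mean_sum (I : Type) (r : seq I) (F : I -> T -> R) :
  (forall i, bmeas (F i)) ->
  \int[P]_x (\sum_(i <- r) F i x) = \sum_(i <- r) \int[P]_x F i x.
Proof.
move=> bF; elim: r => [|i r IH].
  by under eq_Rintegral do rewrite big_nil; rewrite mean_cst big_nil.
under eq_Rintegral do rewrite big_cons.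
by rewrite meanD ?IH ?big_cons//; exact: bmeas_sum.
Qed.

Lemma ler_mean f g : bmeas f -> bmeas g -> (forall x, f x <= g x) ->
  \int[P]_x f x <= \int[P]_x g x.
Proof. by move=> bf bg fg; apply: le_Rintegral => //; exact: bmeas_integrable. Qed.

Lemma mean_norm f (B : R) : bmeas f -> (forall x, `|f x| <= B) ->
  `|\int[P]_x f x| <= B.
Proof.
move=> bf fB; rewrite ler_norml.
rewrite -[X in X <= _](mean_cst (- B)) -[X in _ && (_ <= X)](mean_cst B).
apply/andP; split; apply: ler_mean => //; try exact: bmeas_cst.
  by move=> x; have := fB x; rewrite ler_norml => /andP[].
by move=> x; have := fB x; rewrite ler_norml => /andP[].
Qed.

Lemma mean_indic (A : set T) : measurable A ->
  \int[P]_x (\1_A x : R) = fine (P A).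
Proof. by move=> mA; rewrite /Rintegral integral_indic// setIT. Qed.

End bounded_measurable.

(** * Translations of the normal law *)

Section normal_shift.
Context (R : realType).
Local Notation N := (normal_prob (0 : R) 1).

(** Lebesgue measure is translation invariant, by uniqueness on half-open intervals, and the density
    centred at [h] takes at [t + h] the value of the standard density at [t]. *)
Lemma normal_prob_shift (h : R) (A : set R) : measurable A ->
  normal_prob h 1 A =
  N ((fun t : measurableTypeR R => t + h : measurableTypeR R) @^-1` A).
Proof.
move=> mA; pose phi := (fun t : measurableTypeR R => t + h : measurableTypeR R).
have mphi : measurable_fun setT phi by exact: measurable_funD.
pose m := isMeasurableFun.Build _ _ _ _ phi mphi.
pose phi' : {mfun _ >-> _} := HB.pack phi m.
have lebE (B : set R) : measurable B ->
    pushforward lebesgue_measure phi' B = lebesgue_measure B.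
  move=> mB; apply/esym/lebesgue_measure_unique => //= _ [[a b]] _ <-.
  rewrite /pushforward /=.
  have -> : phi @^-1` [set` `]a, b]] = [set` `]a - h, b - h]].
    by apply/seteqP; split=> t /=; rewrite /phi !in_itv/= ltrBlDr lerBrDr.
  rewrite !lebesgue_measure_itv/= !lte_fin ltrD2r; case: ifP => // _.
  by rewrite -!EFinB; congr EFin; ring.
rewrite /normal_prob.
have mpdf : measurable_fun setT (fun x : R => (normal_pdf h 1 x)%:E).
  by apply/measurable_EFinP; exact: measurable_normal_pdf.
transitivity (\int[pushforward lebesgue_measure phi']_(x in A)
    (normal_pdf h 1 x)%:E)%E.
  by apply: eq_measure_integral => B mB _; exact/esym/lebE.
rewrite ge0_integral_pushforward//=; last 2 first.
- exact: measurable_funTS.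
- by move=> y _; rewrite lee_fin normal_pdf_ge0.
apply: eq_integral => x _ /=; congr EFin.
by rewrite !normal_pdfE ?oner_neq0// /normal_fun /phi addrK subr0.
Qed.

End normal_shift.

Section normal_mean_shift.
Context (R : realType).
Local Notation N := (normal_prob (0 : R) 1).

Lemma EFin_mean (disp : measure_display) (T : measurableType disp)
    (P : probability T R) (f : T -> R) : bmeas f ->
  (\int[P]_x f x)%:E = (\int[P]_x (f x)%:E)%E.
Proof.
by move=> bf; rewrite fineK//; apply: integrable_fin_num => //; exact: bmeas_integrable.
Qed.

(* The density of variance 4 absorbs the factor [|t|] that comes from
   differentiating the standard density. *)
Lemma normal_pdf_shift_le (h t : R) : `|h| <= 1 ->
  normal_pdf 0 1 t <= normal_pdf h 1 t + 4 * `|h| * normal_pdf 0 2 t.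
Proof.
move=> h1; rewrite !normal_pdfE ?oner_neq0 ?pnatr_eq0//.
have -> : normal_peak (2 : R) = normal_peak 1 / 2.
  rewrite /normal_peak expr1n mul1r.
  have -> : (2 ^+ 2 * pi *+ 2 : R) = 2 ^+ 2 * (pi *+ 2) by ring.
  by rewrite sqrtrM ?sqr_ge0// sqrtr_sqr ger0_norm// invfM mulrC.
have p0 : 0 <= normal_peak (1 : R) := normal_peak_ge0 1.
rewrite -subr_ge0.
have -> : normal_peak 1 * normal_fun h 1 t +
    4 * `|h| * (normal_peak 1 / 2 * normal_fun 0 2 t) - normal_peak 1 * normal_fun 0 1 t =
  normal_peak 1 * (normal_fun h 1 t + 2 * `|h| * normal_fun 0 2 t - normal_fun 0 1 t).
  by field.
apply: mulr_ge0 => //.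
rewrite /normal_fun subr0.
set e := expR (- t ^+ 2 / (1 ^+ 2 *+ 2)).
have -> : expR (- (t - h) ^+ 2 / (1 ^+ 2 *+ 2)) = e * expR (h * t - h ^+ 2 / 2).
  by rewrite -expRD expr1n; congr expR; field.
have -> : expR (- t ^+ 2 / (2 ^+ 2 *+ 2)) = e * expR (3 * t ^+ 2 / 8).
  by rewrite -expRD expr1n; congr expR; field.
have e0 : 0 <= e by exact: expR_ge0.
have -> : e * expR (h * t - h ^+ 2 / 2) + 2 * `|h| * (e * expR (3 * t ^+ 2 / 8)) - e =
  e * (expR (h * t - h ^+ 2 / 2) + 2 * `|h| * expR (3 * t ^+ 2 / 8) - 1) by ring.
apply: mulr_ge0 => //.
(* With [exp(-t^2/2)] factored out, [exp u >= 1 + u] suffices, combined with [|t| <= 1 + t^2/4] and,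
   since [|h| <= 1], with [h^2 <= |h|]. *)
have A1 := expR_ge1Dx (h * t - h ^+ 2 / 2).
have A2 := expR_ge1Dx (3 * t ^+ 2 / 8).
have h0 : 0 <= `|h| := normr_ge0 h.
have A3 : 2 * `|h| * (1 + 3 * t ^+ 2 / 8) <= 2 * `|h| * expR (3 * t ^+ 2 / 8).
  by apply: ler_wpM2l => //; rewrite mulr_ge0.
have A4 : - (`|h| * `|t|) <= h * t.
  by rewrite -normrM lerNl -normrN ler_norm.
have hh : h ^+ 2 <= `|h| by rewrite -[h ^+ 2]real_normK ?num_real// expr2 ler_piMl.
have t2 : t ^+ 2 = `|t| ^+ 2 by rewrite real_normK ?num_real.
have A5 : `|h| * `|t| <= `|h| * (1 + `|t| ^+ 2 / 4).
  apply: ler_wpM2l => //; have := sqr_ge0 (`|t| / 2 - 1); nra.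
have A6 : 0 <= `|h| * `|t| ^+ 2 by rewrite mulr_ge0// sqr_ge0.
rewrite t2 in A1 A2 A3 *.
nra.
Qed.

Lemma normal_prob_shift_le (h : R) (A : set (measurableTypeR R)) :
  `|h| <= 1 -> measurable A ->
  (N A <= normal_prob h 1 A + (4 * `|h|)%:E * normal_prob 0 2 A)%E.
Proof.
move=> h1 mA; rewrite /normal_prob.
have mp m s : measurable_fun A (fun x : measurableTypeR R => (normal_pdf m s x)%:E).
  by apply/measurable_EFinP; apply: measurable_funTS; exact: measurable_normal_pdf.
have f0 m s (x : measurableTypeR R) : A x -> (0 <= (normal_pdf m s x)%:E)%E.
  by rewrite lee_fin normal_pdf_ge0.
have k0 : (0 <= (4 * `|h|)%:E)%E by rewrite lee_fin mulr_ge0.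
rewrite -(ge0_integralZl _ mA (mp 0 2) (f0 0 2) k0) -ge0_integralD//.
- apply: ge0_le_integral => //; first exact: f0.
    apply: emeasurable_funD => //; exact: emeasurable_funM.
  by move=> x _; rewrite -EFinM -EFinD lee_fin normal_pdf_shift_le.
- exact: f0.
- by move=> x Ax; rewrite mule_ge0// f0.
- exact: emeasurable_funM.
Qed.

Lemma mean_normal_shift (h : R) (K : measurableTypeR R -> R) : bmeas K ->
  \int[normal_prob h 1]_t K t = \int[N]_t K (t + h).
Proof.
move=> bK; have [mK _] := bK.
pose phi := (fun t : measurableTypeR R => t + h : measurableTypeR R).
have mphi : measurable_fun setT phi by exact: measurable_funD.
pose m := isMeasurableFun.Build _ _ _ _ phi mphi.
pose phi' : {mfun _ >-> _} := HB.pack phi m.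
suff E : (\int[normal_prob h 1]_x (K x)%:E = \int[N]_x (K (x + h))%:E)%E.
  exact: (congr1 fine E).
transitivity (\int[pushforward N phi']_x (K x)%:E)%E.
  by apply: eq_measure_integral => B mB _; exact: normal_prob_shift.
rewrite integral_pushforward//=.
  exact/measurable_EFinP.
by apply: bmeas_integrable; exact: (bmeas_comp mphi bK).
Qed.

(** The comparison of measures needs a nonnegative integrand, hence [K + B]. Its mean under the law
    of variance 4 is at most [2 * B], which gives the factor 8. *)
Lemma mean_shift_le (h B : R) (K : measurableTypeR R -> R) :
  bmeas K -> (forall t, `|K t| <= B) -> `|h| <= 1 ->
  \int[N]_t K t <= \int[N]_t K (t + h) + 8 * B * `|h|.
Proof.
move=> bK KB h1; rewrite -mean_normal_shift//.
pose g t := K t + B.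
have bB : bmeas (fun _ : measurableTypeR R => B) by exact: bmeas_cst.
have bg : bmeas g by exact: bmeasD.
have g0 t : 0 <= g t by have := KB t; rewrite ler_norml /g => /andP[? _]; lra.
have k0 : 0 <= 4 * `|h| by rewrite mulr_ge0.
have mg : measurable_fun setT (fun t => (g t)%:E) by apply/measurable_EFinP; case: bg.
have : (\int[N]_t (g t)%:E <= \int[normal_prob h 1]_t (g t)%:E +
    (4 * `|h|)%:E * \int[normal_prob 0 2]_t (g t)%:E)%E.
  rewrite (_ : 4 * `|h| = (NngNum k0)%:num)//.
  rewrite -ge0_integral_mscale//; last by move=> t _; rewrite lee_fin.
  rewrite -ge0_integral_measure_add//; last by move=> t _; rewrite lee_fin.
  apply: ge0_le_measure_integral => //.
  move=> A mA.
  by rewrite /= /msum !big_ord_recr big_ord0/= add0e; exact: normal_prob_shift_le.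
rewrite -!EFin_mean// -EFinM -EFinD lee_fin !meanD// !mean_cst.
have : \int[normal_prob 0 2]_t K t <= B.
  by apply: le_trans (ler_norm _) _; exact: mean_norm.
set a := Rintegral _ _ _; set b := Rintegral _ _ _; set c := Rintegral _ _ _.
nra.
Qed.

(** The one-sided bound is applied to [K] and to [- K]; for [|h| > 1] the difference is at most
    [2 * B] anyway. *)
Lemma mean_shift (h B : R) (K : measurableTypeR R -> R) :
  bmeas K -> (forall t, `|K t| <= B) ->
  `|\int[N]_t K t - \int[N]_t K (t + h)| <= 8 * B * `|h|.
Proof.
move=> bK KB.
have B0 : 0 <= B := le_trans (normr_ge0 _) (KB 0).
have bKh : bmeas (fun t : measurableTypeR R => K (t + h)).
  by apply: (bmeas_comp _ bK); exact: measurable_funD.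
have [h1|h1] := leP `|h| 1.
  have L1 := mean_shift_le bK KB h1.
  have KB' t : `|- K t| <= B by rewrite normrN.
  have := mean_shift_le (bmeasN bK) KB' h1; rewrite !meanN// => L2.
  rewrite ler_norml; apply/andP; split; lra.
apply: le_trans (ler_normB _ _) _.
have L1 : `|\int[N]_t K t| <= B by exact: mean_norm.
have L2 : `|\int[N]_t K (t + h)| <= B by exact: mean_norm.
apply: le_trans (lerD L1 L2) _.
by have := ler_wpM2l B0 (ltW h1); clear -B0 => ?; lra.
Qed.

End normal_mean_shift.

(** * Integrating the Gaussian one coordinate at a time *)

Section gaussian_fubini.
Context (R : realType).
Local Notation N := (normal_prob (0 : R) 1).

Lemma bmeas_sectionr (d1 d2 : measure_display) (T1 : measurableType d1)
    (T2 : measurableType d2) (K : T1 * T2 -> R) (a : T1) :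
  bmeas K -> bmeas (fun y => K (a, y)).
Proof. by move=> bK; apply: (bmeas_comp _ bK); exact: measurable_pair1. Qed.

Lemma bmeas_fubini_F (d1 d2 : measure_display) (T1 : measurableType d1)
    (T2 : measurableType d2) (P1 : probability T1 R) (P2 : probability T2 R)
    (K : T1 * T2 -> R) : bmeas K -> bmeas (fun x => \int[P2]_y K (x, y)).
Proof.
move=> bK; split.
  apply: measurableT_comp => //.
  have := bmeas_integrable (P1 \x P2)%E bK.
  exact: measurable_fubini_F.
have [_ [B KB]] := bK; exists B => x; apply: mean_norm => //.
exact: bmeas_sectionr.
Qed.

Lemma mean_prod (d1 d2 : measure_display) (T1 : measurableType d1)
    (T2 : measurableType d2) (P1 : probability T1 R) (P2 : probability T2 R)
    (K : T1 * T2 -> R) : bmeas K ->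
  \int[(P1 \x P2)%E]_z K z = \int[P1]_x \int[P2]_y K (x, y).
Proof.
move=> bK; rewrite [LHS]/Rintegral.
rewrite -(integral12_prod_meas1 (bmeas_integrable (P1 \x P2)%E bK)).
congr fine; apply: eq_integral => x _.
by rewrite EFin_mean//; exact: bmeas_sectionr.
Qed.

Lemma bmeas_vec_cons (n : nat) (K : vec R n.+1 -> R) : bmeas K ->
  bmeas (fun p => K (@vec_cons R n p)).
Proof. by move=> bK; apply: (bmeas_comp _ bK); exact: measurable_vec_cons. Qed.

Lemma bmeas_gaussian_marginal (n : nat) (K : vec R n.+1 -> R) : bmeas K ->
  bmeas (fun t : measurableTypeR R => \int[gaussian R n]_x K (vec_cons (t, x))).
Proof. by move/bmeas_vec_cons; exact: (@bmeas_fubini_F _ _ _ _ N (gaussian R n)). Qed.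

(** Fubini for the first coordinate; the inductions on the dimension below rest on this identity. *)
Lemma gaussian_mean (n : nat) (K : vec R n.+1 -> R) : bmeas K ->
  \int[gaussian R n.+1]_x K x =
  \int[N]_t \int[gaussian R n]_x K (vec_cons (t, x)).
Proof.
move=> bK; rewrite -(mean_prod _ _ (bmeas_vec_cons bK)).
apply: EFin_inj; rewrite EFin_mean// EFin_mean; last exact: bmeas_vec_cons.
rewrite [LHS]integral_distribution//=.
  by apply/measurable_EFinP; case: bK.
apply: bmeas_integrable; exact: bmeas_vec_cons.
Qed.

End gaussian_fubini.

(** * The square wave *)

Section square_wave.
Context (R : realType).

Definition wave (u : R) : R := (-1) ^ Num.floor u.

Lemma waveS (u : R) : wave (u + 1) = - wave u.
Proof.
by rewrite /wave floorDrz ?rpred1// floor1 exprzDr ?unitrN1// expr1z mulrN1.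
Qed.

Lemma wave_val (u : R) : wave u = 1 \/ wave u = -1.
Proof.
rewrite /wave; case: (Num.floor u) => n.
  by rewrite -exprnP -signr_odd; case: odd; [right|left].
by rewrite NegzE -exprnN -exprVn invrN1 -signr_odd; case: odd; [right|left].
Qed.

Lemma norm_wave (u : R) : `|wave u| = 1.
Proof. by case: (wave_val u) => ->; rewrite ?normrN normr1. Qed.

Lemma wave_unit (u : R) : 0 <= u < 1 -> wave u = 1.
Proof. by move=> u01; rewrite /wave (@floor_def _ u 0)// add0r. Qed.

(** The wave is constant on each of countably many unit intervals, so a preimage is a countable
    union of them. *)
Lemma measurable_wave : measurable_fun setT wave.
Proof.
move=> _ Y _; rewrite setTI.
have -> : wave @^-1` Y =
    \bigcup_(k : int) [set u | Y ((-1) ^ k) /\ u \in `[k%:~R, (k + 1)%:~R[].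
  apply/seteqP; split=> [u Yu|u [k _ [Yk]]] /=.
    exists (Num.floor u) => //; split => //.
    by rewrite in_itv/= floor_itv.
  by rewrite in_itv/= => /floor_def; rewrite /wave => ->.
apply: countable_bigcupT_measurable => // k.
have [Yk|nYk] := pselect (Y ((-1) ^ k)).
  rewrite (_ : [set _ | _] = [set` `[k%:~R, (k + 1)%:~R[])//.
  by apply/seteqP; split=> u /= => [[]|].
rewrite (_ : [set _ | _] = set0)//.
by apply/seteqP; split=> u //= [].
Qed.

End square_wave.

(** * Waves and signs of linear forms *)

Section linear_forms.
Context (R : realType).

Definition lin (n : nat) (w x : vec R n) : R := \sum_(i < n) tnth w i * tnth x i.

Lemma lin_cons (n : nat) (a t : R) (w x : vec R n) :
  lin (vec_cons (a, w)) (vec_cons (t, x)) = a * t + lin w x.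
Proof.
rewrite /lin big_ord_recl !tnth0; congr (_ + _).
by apply: eq_bigr => i _; rewrite !tnthS.
Qed.

Lemma vec_consE (n : nat) (w : vec R n.+1) : exists a w', w = vec_cons (a, w').
Proof.
exists (thead w), [tuple of behead w].
by rewrite [LHS]tuple_eta; apply/val_inj.
Qed.

Lemma measurable_lin (n : nat) (w : vec R n) : measurable_fun setT (lin w).
Proof.
apply: measurable_sum => i; apply: measurable_funM => //.
exact: measurable_tnth.
Qed.

Lemma halfspaceE (n : nat) (w : vec R n) (theta : R) x :
  halfspace w theta x = sign (lin w x + theta).
Proof. by []. Qed.

Lemma sign_val (t : R) : sign t = 1 \/ sign t = -1.
Proof. by rewrite /sign; case: ifP; [left|right]. Qed.

Lemma norm_sign (t : R) : `|sign t| = 1.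
Proof. by case: (sign_val t) => ->; rewrite ?normrN normr1. Qed.

Lemma measurable_sign : measurable_fun setT (@sign R).
Proof. by apply: measurable_fun_if => //; exact: measurable_fun_ler. Qed.

Lemma bmeas_wave_lin (n : nat) (w : vec R n) (c : R) :
  bmeas (fun x => wave (lin w x + c)).
Proof.
split; last by exists 1 => x; rewrite norm_wave.
apply: measurableT_comp; first exact: measurable_wave.
by apply: measurable_funD => //; exact: measurable_lin.
Qed.

Lemma bmeas_sign_lin (n : nat) (w : vec R n) (c : R) :
  bmeas (fun x => sign (lin w x + c)).
Proof.
split; last by exists 1 => x; rewrite norm_sign.
apply: measurableT_comp; first exact: measurable_sign.
by apply: measurable_funD => //; exact: measurable_lin.
Qed.

End linear_forms.

(** * Correlations between plane waves *)

Section wave_correlations.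
Context (R : realType).
Local Notation N := (normal_prob (0 : R) 1).

(** The phases [c] and [c'] serve the induction on the dimension: fixing one coordinate only changes
    them. *)
Definition cross (n : nat) (w w' : vec R n) (c c' : R) : R :=
  \int[gaussian R n]_x (wave (lin w x + c) * wave (lin w' x + c')).

Lemma bmeas_wave2 (n : nat) (w w' : vec R n) (c c' : R) :
  bmeas (fun x => wave (lin w x + c) * wave (lin w' x + c')).
Proof. by apply: bmeasM; exact: bmeas_wave_lin. Qed.

Lemma cross_consE (n : nat) (w w' : vec R n) (a a' c c' : R) :
  (fun t : measurableTypeR R => cross w w' (c + a * t) (c' + a' * t)) =
  (fun t => \int[gaussian R n]_x
     (wave (lin (vec_cons (a, w)) (vec_cons (t, x)) + c) *
      wave (lin (vec_cons (a', w')) (vec_cons (t, x)) + c'))).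
Proof.
apply/funext => t; apply: eq_Rintegral => x _; rewrite !lin_cons.
by congr (wave _ * wave _); ring.
Qed.

Lemma cross_cons (n : nat) (w w' : vec R n) (a a' c c' : R) :
  cross (vec_cons (a, w)) (vec_cons (a', w')) c c' =
  \int[N]_t cross w w' (c + a * t) (c' + a' * t).
Proof.
rewrite [LHS]gaussian_mean; last exact: bmeas_wave2.
by rewrite -cross_consE.
Qed.

Lemma bmeas_cross (n : nat) (w w' : vec R n) (a a' c c' : R) :
  bmeas (fun t : measurableTypeR R => cross w w' (c + a * t) (c' + a' * t)).
Proof.
rewrite cross_consE.
have := bmeas_wave2 (vec_cons (a, w)) (vec_cons (a', w')) c c'.
exact: bmeas_gaussian_marginal.
Qed.

Lemma cross_le1 (n : nat) (w w' : vec R n) (c c' : R) : `|cross w w' c c'| <= 1.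
Proof.
apply: mean_norm => [|x]; first exact: bmeas_wave2.
by rewrite normrM !norm_wave mulr1.
Qed.

Lemma cross_anti (n : nat) (w w' : vec R n) (c c' : R) :
  cross w w' (c + 1) c' = - cross w w' c c'.
Proof.
rewrite /cross -meanN; last exact: bmeas_wave2.
by apply: eq_Rintegral => x _; rewrite addrA waveS mulNr.
Qed.

Lemma cross_cons_le (n : nat) (w w' : vec R n) (B : R) :
  (forall c c', `|cross w w' c c'| <= B) ->
  forall a a' c c', `|cross (vec_cons (a, w)) (vec_cons (a', w')) c c'| <= B.
Proof.
move=> wB a a' c c'; rewrite cross_cons; apply: mean_norm => // ; exact: bmeas_cross.
Qed.

(** Translating the first coordinate by [h] moves the phases by [a * h] and [a' * h], so
    [mean_shift] applies to the correlation of the remaining coordinates. *)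
Lemma cross_shift (n : nat) (w w' : vec R n) (B : R) :
  (forall c c', `|cross w w' c c'| <= B) -> forall a a' h c c',
  `|cross (vec_cons (a, w)) (vec_cons (a', w')) c c' -
    cross (vec_cons (a, w)) (vec_cons (a', w')) (c + a * h) (c' + a' * h)|
    <= 8 * B * `|h|.
Proof.
move=> wB a a' h c c'; rewrite !cross_cons.
have -> : \int[N]_t cross w w' (c + a * h + a * t) (c' + a' * h + a' * t) =
    \int[N]_t cross w w' (c + a * (t + h)) (c' + a' * (t + h)).
  by apply: eq_Rintegral => t _; congr cross; ring.
by apply: (@mean_shift R h B (fun t => cross w w' (c + a * t) (c' + a' * t)));
  first exact: bmeas_cross.
Qed.

(** Translating the two coordinates by [h1] and [h2] moves the first phase by 1 and the second by 0,
    which negates the correlation. Twice the correlation is thus at most the cost [8 * B] times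
    [|h1| + |h2|] of the two translations. *)
Lemma cross_pair (n : nat) (w w' : vec R n) (B : R) (a b b' h1 h2 c c' : R) :
  (forall c c', `|cross w w' c c'| <= B) ->
  b * h1 + a * h2 = 1 -> b' * h1 + a * h2 = 0 ->
  `|cross (vec_cons (b, vec_cons (a, w))) (vec_cons (b', vec_cons (a, w'))) c c'|
    <= 4 * B * (`|h1| + `|h2|).
Proof.
move=> wB e1 e0.
set v := vec_cons (a, w); set v' := vec_cons (a, w').
have vB : forall c c', `|cross v v' c c'| <= B by move=> *; exact: cross_cons_le.
set u := vec_cons (b, v); set u' := vec_cons (b', v').
have L1 := cross_shift vB b b' h1 c c'.
have L2 : `|cross u u' (c + b * h1) (c' + b' * h1) - cross u u' (c + 1) c'|
    <= 8 * B * `|h2|.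
  have E1 : c + 1 = c + b * h1 + a * h2 by rewrite -addrA e1.
  have E0 : c' = c' + b' * h1 + a * h2 by rewrite -addrA e0 addr0.
  rewrite [X in _ - cross u u' X _]E1 [X in _ - cross u u' _ X]E0.
  (* The translation by [h2] takes place under the integral over the first coordinate. *)
  rewrite !cross_cons -meanB; [|exact: bmeas_cross..].
  apply: mean_norm; first by apply: bmeasB; exact: bmeas_cross.
  move=> t.
  have := cross_shift wB a a h2 (c + b * h1 + b * t) (c' + b' * h1 + b' * t).
  by rewrite (addrAC _ _ (a * h2)) (addrAC (c' + _) _ (a * h2)).
rewrite cross_anti -/u -/u' in L1 L2.
move: L1 L2; set x := cross u u' _ _; set y := cross u u' _ _.
rewrite opprK !ler_norml => /andP[? ?] /andP[? ?].
by apply/andP; split; lra.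
Qed.

(** Coordinates are built from the last one, so the innermost always has frequency [nu * M], and an
    odd dimension leaves an unpaired [M] in front. The entry [M], common to all vectors and larger
    than every digit, lets a short translation undo the phase change caused by a digit. *)
Fixpoint freq (nu : R) (M : nat) (j : nat -> nat) (n : nat) : vec R n :=
  match n with
  | 0 => [tuple]
  | k.+1 => vec_cons (nu * (if odd k then j k./2 else M)%:R, freq nu M j k)
  end.

Lemma cross_freq_even (nu : R) (M : nat) (j j' : nat -> nat) (k : nat) (c c' : R) :
  0 < nu -> (forall i, (j i < M)%N) -> (forall i, (j' i < M)%N) ->
  `|cross (freq nu M j k.*2) (freq nu M j' k.*2) c c'| <=
  \prod_(i < k) (if j i == j' i then 1 else 8 / nu).
Proof.
move=> nu0 jM j'M; elim: k c c' => [|k IH] c c'.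
  by rewrite big_ord0; exact: cross_le1.
rewrite big_ord_recr /= odd_double uphalf_double /=.
set B := \prod_(i < k) _ in IH *.
have [->|jj'] := eqVneq (j k) (j' k).
  rewrite mulr1; apply: cross_cons_le => ? ?; exact: cross_cons_le.
have M0 : (0 < M)%N by exact: leq_ltn_trans (jM 0%N).
have M0' : 0 < M%:R :> R by rewrite ltr0n.
have D0 : (j k)%:R - (j' k)%:R != 0 :> R by rewrite subr_eq0 eqr_nat.
have D1 : 1 <= `|(j k)%:R - (j' k)%:R| :> R.
  have -> : (j k)%:R - (j' k)%:R = ((j k)%:Z - (j' k)%:Z)%:~R :> R.
    by rewrite rmorphB.
  rewrite -intr_norm ler1z -gtz0_ge1 normr_gt0 subr_eq0.
  by apply: contra_neq jj' => -[].
set D : R := (j k)%:R - (j' k)%:R in D0 D1.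
(* The solution of the two equations of [cross_pair] for [b = nu * j k], [b' = nu * j' k],
   [a = nu * M]. Both lengths are at most [1 / nu], as distinct integers differ by at least 1 and
   [j' k < M]. *)
pose h1 := (nu * D)^-1; pose h2 := - ((j' k)%:R * h1 / M%:R).
have nun : nu != 0 by rewrite gt_eqF.
have Mn : M%:R != 0 :> R by rewrite gt_eqF.
have Dn : (j k)%:R - (j' k)%:R != 0 :> R by [].
apply: le_trans (@cross_pair _ _ _ B _ _ _ h1 h2 _ _ IH _ _) _.
- by rewrite /h2 /h1 /D; field; apply/and3P; split.
- by rewrite /h2 /h1 /D; field; apply/and3P; split.
have H1 : `|h1| <= nu^-1.
  rewrite /h1 normfV normrM gtr0_norm// invfM ler_piMr ?invr_ge0 ?(ltW nu0)//.
  by rewrite invf_le1// (lt_le_trans _ D1).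
have H2 : `|h2| <= nu^-1.
  rewrite /h2 normrN !normrM (normfV M%:R) (gtr0_norm M0') (ger0_norm (ler0n _ (j' k))).
  rewrite ler_pdivrMr// mulrC; apply: ler_pM => //.
  by rewrite ler_nat ltnW.
have B0 : 0 <= B := le_trans (normr_ge0 _) (IH 0 0).
have -> : B * (8 / nu) = 4 * B * (nu^-1 + nu^-1) by ring.
by apply: ler_wpM2l; [rewrite mulr_ge0|exact: lerD].
Qed.

Lemma cross_freq (nu : R) (M : nat) (j j' : nat -> nat) (n : nat) (c c' : R) :
  0 < nu -> (forall i, (j i < M)%N) -> (forall i, (j' i < M)%N) ->
  `|cross (freq nu M j n) (freq nu M j' n) c c'| <=
  \prod_(i < n./2) (if j i == j' i then 1 else 8 / nu).
Proof.
move=> nu0 jM j'M; rewrite -{1 2 3}(odd_double_half n).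
case: odd; last exact: cross_freq_even.
by apply: cross_cons_le => ? ?; exact: cross_freq_even.
Qed.

End wave_correlations.

(** * Correlations between waves and halfspaces *)

Section wave_halfspace.
Context (R : realType).
Local Notation N := (normal_prob (0 : R) 1).

Definition hcorr (n : nat) (w w' : vec R n) (c c' : R) : R :=
  \int[gaussian R n]_x (wave (lin w x + c) * sign (lin w' x + c')).

Lemma bmeas_wave_sign (n : nat) (w w' : vec R n) (c c' : R) :
  bmeas (fun x => wave (lin w x + c) * sign (lin w' x + c')).
Proof. by apply: bmeasM; [exact: bmeas_wave_lin|exact: bmeas_sign_lin]. Qed.

Lemma hcorr_consE (n : nat) (w w' : vec R n) (a a' c c' : R) :
  (fun t : measurableTypeR R => hcorr w w' (c + a * t) (c' + a' * t)) =
  (fun t => \int[gaussian R n]_x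
     (wave (lin (vec_cons (a, w)) (vec_cons (t, x)) + c) *
      sign (lin (vec_cons (a', w')) (vec_cons (t, x)) + c'))).
Proof.
apply/funext => t; apply: eq_Rintegral => x _; rewrite !lin_cons.
by congr (wave _ * sign _); ring.
Qed.

Lemma hcorr_cons (n : nat) (w w' : vec R n) (a a' c c' : R) :
  hcorr (vec_cons (a, w)) (vec_cons (a', w')) c c' =
  \int[N]_t hcorr w w' (c + a * t) (c' + a' * t).
Proof.
rewrite [LHS]gaussian_mean; last exact: bmeas_wave_sign.
by rewrite -hcorr_consE.
Qed.

Lemma bmeas_hcorr (n : nat) (w w' : vec R n) (a a' c c' : R) :
  bmeas (fun t : measurableTypeR R => hcorr w w' (c + a * t) (c' + a' * t)).
Proof.
rewrite hcorr_consE.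
have := bmeas_wave_sign (vec_cons (a, w)) (vec_cons (a', w')) c c'.
exact: bmeas_gaussian_marginal.
Qed.

Lemma measurable_affine (a c : R) :
  measurable_fun setT (fun t : measurableTypeR R => c + a * t : measurableTypeR R).
Proof. by apply: measurable_funD => //; exact: measurable_funM. Qed.

(* The threshold is monotone in [t], so the mean of the absolute value of its
   increment is again a difference of shifted means. *)
Lemma wave_sign_normal_le (a b c c' : R) : 0 < a ->
  `|\int[N]_t (wave (c + a * t) * sign (c' + b * t))| <= 8 / a.
Proof.
move=> a0; pose sg (t : measurableTypeR R) : R := sign (c' + b * t).
pose wv (t : measurableTypeR R) : R := wave (c + a * t).
have bsg : bmeas sg.
  split; last by exists 1 => x; rewrite norm_sign.
  apply: measurableT_comp; first exact: measurable_sign.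
  exact: measurable_affine.
have bwv : bmeas wv.
  split; last by exists 1 => x; rewrite norm_wave.
  apply: measurableT_comp; first exact: measurable_wave.
  exact: measurable_affine.
(* Translation by [1 / a] negates the wave. The mean of [g] is half the sum of the quantities
   bounded in [L1] and [L3], each at most [8 * h]. *)
pose h := a^-1; have h0 : 0 < h by rewrite invr_gt0.
have wvh t : wv (t + h) = - wv t.
  by rewrite /wv mulrDr divff ?gt_eqF// addrA waveS.
pose g t := wv t * sg t.
have bg : bmeas g by exact: bmeasM.
have mh : measurable_fun setT (fun t : measurableTypeR R => t + h : measurableTypeR R).
  exact: measurable_funD.
have bgh := bmeas_comp mh bg; have bsgh := bmeas_comp mh bsg.
have L1 : `|\int[N]_t g t - \int[N]_t g (t + h)| <= 8 * 1 * `|h|.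
  by apply: mean_shift => // t; rewrite normrM norm_wave norm_sign mulr1.
have L2 : `|\int[N]_t sg t - \int[N]_t sg (t + h)| <= 8 * 1 * `|h|.
  by apply: mean_shift => // t; rewrite norm_sign.
have L3 : `|\int[N]_t g t + \int[N]_t g (t + h)| <= 8 * 1 * `|h|.
  apply: le_trans L2; rewrite -meanD// -meanB//.
  have bd : bmeas (fun t : measurableTypeR R => sg t - sg (t + h)) by exact: bmeasB.
  have -> : \int[N]_t (g t + g (t + h)) = \int[N]_t (wv t * (sg t - sg (t + h))).
    by apply: eq_Rintegral => t _; rewrite /g wvh mulrBr mulNr.
  apply: (@le_trans _ _ (\int[N]_t `|sg t - sg (t + h)|)).
    apply: le_trans (le_normr_Rintegral _ _) _ => //.
      by apply: bmeas_integrable; exact: bmeasM.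
    apply: ler_mean; [by apply: bmeas_norm; exact: bmeasM|exact: bmeas_norm|].
    by move=> t; rewrite normrM norm_wave mul1r.
  have [b0|b0] := leP 0 b.
    have M t : sg t - sg (t + h) <= 0.
      rewrite subr_le0 /sg /sign mulrDr addrA.
      have bh : 0 <= b * h by rewrite mulr_ge0// ltW.
      by case: (leP 0 (c' + b * t)) => ?; case: (leP 0 (c' + b * t + _)) => ?; lra.
    under eq_Rintegral do rewrite ler0_norm//.
    by rewrite meanN// -normrN ler_norm.
  have M t : 0 <= sg t - sg (t + h).
    rewrite subr_ge0 /sg /sign mulrDr addrA.
    have bh : b * h <= 0 by rewrite mulr_le0_ge0// ltW.
    by case: (leP 0 (c' + b * t)) => ?; case: (leP 0 (c' + b * t + _)) => ?; lra.
  under eq_Rintegral do rewrite ger0_norm//.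
  exact: ler_norm.
rewrite -[X in `|X|]/(\int[N]_t g t).
rewrite (gtr0_norm h0) in L1 L3.
rewrite -[8 / a]/(8 * h).
move: L1 L3; set x := Rintegral _ _ _; set y := Rintegral _ _ _.
rewrite !ler_norml => /andP[? ?] /andP[? ?].
by apply/andP; split; lra.
Qed.

(** The innermost coordinate, of frequency [nu * M], already gives this bound uniformly in the
    phases, and averaging over the other coordinates preserves it. *)
Lemma hcorr_freq_le (nu : R) (M : nat) (j : nat -> nat) (n : nat)
    (w : vec R n.+1) (c c' : R) : 0 < nu -> (0 < M)%N ->
  `|hcorr (freq nu M j n.+1) w c c'| <= 8 / (nu * M%:R).
Proof.
move=> nu0 M0; elim: n w c c' => [|n IH] w c c'; have [a [w' ->]] := vec_consE w.
  rewrite [freq _ _ _ _]/= hcorr_cons.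
  under eq_Rintegral => t _.
    rewrite /hcorr; under eq_Rintegral => x _.
      rewrite /lin !big_ord0 !add0r; over.
    rewrite mean_cst; over.
  by apply: wave_sign_normal_le; rewrite mulr_gt0// ltr0n.
rewrite [freq _ _ _ _]/= hcorr_cons; apply: mean_norm; first exact: bmeas_hcorr.
by move=> t; exact: IH.
Qed.

(** At [c = 0] this is the mass of the overlap of the two competing halfspaces; other phases [c]
    occur in the induction on the dimension. *)
Definition slab (n : nat) (w : vec R n) (c : R) : R :=
  \int[gaussian R n]_x (\1_(`[0, 2^-1]%classic) (lin w x + c)).

Lemma bmeas_slab_fun (n : nat) (w : vec R n) (c : R) :
  bmeas (fun x => \1_(`[0, 2^-1]%classic) (lin w x + c) : R).
Proof.
have b1 : bmeas (\1_(`[0, 2^-1]%classic) : measurableTypeR R -> R) by exact: bmeas_indic.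
apply: (@bmeas_comp R _ _ _ _ _ (fun x => lin w x + c : measurableTypeR R) _ b1).
by apply: measurable_funD => //; exact: measurable_lin.
Qed.

Lemma slab_consE (n : nat) (w : vec R n) (a c : R) :
  (fun t : measurableTypeR R => slab w (c + a * t)) =
  (fun t => \int[gaussian R n]_x
     (\1_(`[0, 2^-1]%classic) (lin (vec_cons (a, w)) (vec_cons (t, x)) + c))).
Proof.
apply/funext => t; apply: eq_Rintegral => x _; rewrite !lin_cons.
by congr (\1_ _ _); ring.
Qed.

Lemma slab_cons (n : nat) (w : vec R n) (a c : R) :
  slab (vec_cons (a, w)) c = \int[N]_t slab w (c + a * t).
Proof.
rewrite [LHS]gaussian_mean; last exact: bmeas_slab_fun.
by rewrite -slab_consE.
Qed.

Lemma bmeas_slab (n : nat) (w : vec R n) (a c : R) :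
  bmeas (fun t : measurableTypeR R => slab w (c + a * t)).
Proof.
rewrite slab_consE.
exact: (bmeas_gaussian_marginal (bmeas_slab_fun (vec_cons (a, w)) c)).
Qed.

Lemma slab_ge0 (n : nat) (w : vec R n) (c : R) : 0 <= slab w c.
Proof. by apply: Rintegral_ge0 => x _; rewrite indicE. Qed.

(** On [[-L, L]] the standard density is smallest at the endpoints. *)
Lemma normal_itv_ge (a b L : R) : a <= b -> - L <= a -> b <= L ->
  (b - a) * normal_pdf 0 1 L <= fine (N `[a, b]%classic).
Proof.
move=> ab La bL; rewrite -lee_fin fineK; last first.
  exact: (fin_num_measure N).
have -> : ((b - a) * normal_pdf 0 1 L)%:E =
    (\int[lebesgue_measure]_(x in `[a, b]%classic) (normal_pdf 0 1 L)%:E)%E.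
  rewrite integral_cst//= lebesgue_measure_itv/= lte_fin.
  have [ltab|ltba] := ltP a b; first by rewrite -EFinB -EFinM mulrC.
  by rewrite (le_anti (_ : a <= b <= a)) ?ab ?ltba// subrr mul0r mule0.
rewrite /normal_prob; apply: ge0_le_integral => //.
- by move=> x _; rewrite lee_fin normal_pdf_ge0.
- by apply/measurable_EFinP; apply: measurable_funTS; exact: measurable_normal_pdf.
move=> x /=; rewrite in_itv/= => /andP[ax xb].
rewrite lee_fin !normal_pdfE ?oner_neq0//.
apply: ler_wpM2l; first exact: normal_peak_ge0.
rewrite ler_expR !subr0 expr1n ler_pM2r ?invr_gt0// lerN2.
by rewrite -[x ^+ 2]real_normK ?num_real// lerXn2r ?nnegrE ?normr_ge0 ?ler_norml;
  lra.
Qed.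

(** A further coordinate kept in [[-1, 1]] moves the phase by at most [nu * M], so the induction
    passes from [B + 1] in the lower dimension to [B]. The order of quantifiers matters: [kappa] is
    independent of [nu], [M] and the digits. *)
Lemma slab_freq_ge (n : nat) (B : R) : 0 <= B -> exists2 kappa : R, 0 < kappa &
  forall (nu : R) (M : nat) (j : nat -> nat) (c : R),
  0 < nu -> (forall i, (j i < M)%N) -> 1 <= nu * M%:R ->
  `|c| <= B * (nu * M%:R) ->
  kappa / (nu * M%:R) <= slab (freq nu M j n.+1) c.
Proof.
have pdf0 (L : R) : 0 < normal_pdf 0 1 L.
  by rewrite normal_pdfE ?oner_neq0// mulr_gt0 ?expR_gt0// normal_peak_gt0// oner_neq0.
elim: n B => [|n IH] B B0.
  (* In dimension 1 the slab is an interval of length [1 / (2 * nu * M)], contained in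
     [[-(B + 1), B + 1]] because [1 <= nu * M]. *)
  exists (2^-1 * normal_pdf 0 1 (B + 1)); first by rewrite mulr_gt0// invr_gt0.
  move=> nu M j c nu0 jM w1 cB; set w := nu * M%:R in w1 cB *.
  have w0 : 0 < w by lra.
  rewrite [freq _ _ _ _]/= slab_cons.
  under eq_Rintegral => t _.
    rewrite /slab; under eq_Rintegral => x _.
      rewrite /lin !big_ord0 !add0r; over.
    rewrite mean_cst; over.
  rewrite -/w.
  have -> : \int[N]_t (\1_(`[0, 2^-1]%classic) (c + w * t)) =
      \int[N]_t (\1_(`[- (c / w), (2^-1 - c) / w]%classic) t).
    apply: eq_Rintegral => t _; rewrite !indicE; congr (_%:R); congr (nat_of_bool _).
    apply/idP/idP; rewrite !inE/= !in_itv/= => /andP[A1 A2]; apply/andP; split.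
    - by rewrite -mulNr ler_pdivrMr//; lra.
    - by rewrite ler_pdivlMr//; lra.
    - by move: A1; rewrite -mulNr ler_pdivrMr//; lra.
    - by move: A2; rewrite ler_pdivlMr//; lra.
  rewrite mean_indic//.
  have cw : `|c / w| <= B by rewrite normrM normfV (gtr0_norm w0) ler_pdivrMr.
  have w2 : 2^-1 / w <= 1 by rewrite ler_pdivrMr//; lra.
  have e : (2^-1 - c) / w = 2^-1 / w - c / w by rewrite mulrBl.
  have w3 : 0 <= 2^-1 / w by rewrite divr_ge0 ?invr_ge0// ltW.
  move: cw; rewrite ler_norml => /andP[c1 c2].
  apply: le_trans (normal_itv_ge (L := B + 1) _ _ _); last 3 first.
  - by rewrite e; lra.
  - by lra.
  - by rewrite e; lra.
  by rewrite e opprK subrK mulrAC.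
have [|kappa k0 kP] := IH (B + 1); first lra.
pose p := fine (N `[(-1 : R), 1]%classic).
have p0 : 0 < p.
  apply: lt_le_trans (@normal_itv_ge (-1) 1 1 _ _ _); [|lra..].
  by rewrite mulr_gt0//; lra.
exists (p * kappa); first exact: mulr_gt0.
move=> nu M j c nu0 jM w1 cB; set w := nu * M%:R in w1 cB *.
have w0 : 0 < w by lra.
rewrite [freq _ _ _ _]/= slab_cons.
pose a : R := nu * (if ~~ odd n then j (uphalf n) else M)%:R.
have aw : `|a| <= w.
  rewrite /a normrM (gtr0_norm nu0) ler_wpM2l ?(ltW nu0)// ger0_norm// ler_nat.
  by case: ifP => // _; exact: ltnW.
have -> : p * kappa / w = \int[N]_t (kappa / w * \1_(`[(-1 : R), 1]%classic) t).
  rewrite meanZ ?mean_indic//; last exact: bmeas_indic.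
  by rewrite -/p; ring.
apply: ler_mean; first by apply: bmeasZ; exact: bmeas_indic.
  exact: bmeas_slab.
move=> t; rewrite indicE; case: (boolP (t \in _)); last by rewrite mulr0 slab_ge0.
rewrite inE/= in_itv/= => t1; rewrite mulr1; apply: kP => //.
apply: le_trans (ler_normD _ _) _; rewrite mulrDl mul1r lerD//.
rewrite normrM -[leRHS]mulr1; apply: ler_pM => //.
by rewrite ler_norml.
Qed.

End wave_halfspace.

(** * The hard functions: pairwise correlations and distance to halfspaces *)

Section hard_functions.
Context (R : realType).

(** The extension by 0 to all indices fits the type expected by [freq] and stays below any positive
    [M]. *)
Definition digits (k M : nat) (v : {ffun 'I_k -> 'I_M}) (i : nat) : nat :=
  if insub i is Some o then val (v o) else 0%N.

Lemma digitsE (k M : nat) (v : {ffun 'I_k -> 'I_M}) (i : 'I_k) :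
  digits v i = v i.
Proof. by rewrite /digits valK. Qed.

Lemma digits_lt (k M : nat) (v : {ffun 'I_k -> 'I_M}) (i : nat) :
  (0 < M)%N -> (digits v i < M)%N.
Proof. by rewrite /digits; case: insub => // o _; exact: ltn_ord. Qed.

Definition hard (nu : R) (M d : nat) (v : {ffun 'I_d./2 -> 'I_M})
  (x : vec R d) : R := wave (lin (freq nu M (digits v) d) x).

Lemma hardE (nu : R) (M d : nat) (v : {ffun 'I_d./2 -> 'I_M}) :
  hard nu v = fun x => wave (lin (freq nu M (digits v) d) x + 0).
Proof. by apply/funext => x; rewrite addr0. Qed.

Lemma bmeas_hard (nu : R) (M d : nat) (v : {ffun 'I_d./2 -> 'I_M}) :
  bmeas (hard nu v).
Proof. by rewrite hardE; exact: bmeas_wave_lin. Qed.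

Lemma sign_valued_hard (nu : R) (M d : nat) (v : {ffun 'I_d./2 -> 'I_M}) :
  sign_valued (hard nu v).
Proof. by split; [case: (bmeas_hard nu v)|move=> x; exact: wave_val]. Qed.

(** The bound of [cross_freq] is a product over digits, so its sum over all digit vectors
    factorizes. Each factor is at most [1 + M * (8 / nu) <= 9]. *)
Lemma hard_row_sum (nu : R) (M d : nat) (v : {ffun 'I_d./2 -> 'I_M}) :
  (0 < M)%N -> M%:R <= nu ->
  \sum_(w : {ffun 'I_d./2 -> 'I_M})
    `|\int[gaussian R d]_x (hard nu v x * hard nu w x)| <= 9 ^+ d./2.
Proof.
move=> M0 Mnu.
have nu0 : 0 < nu by apply: lt_le_trans Mnu; rewrite ltr0n.
apply: (@le_trans _ _ (\sum_(w : {ffun 'I_d./2 -> 'I_M})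
    \prod_(i < d./2) (if v i == w i then 1 else 8 / nu))).
  apply: ler_sum => w _; rewrite !hardE -/(cross _ _ _ _).
  apply: le_trans (cross_freq _ _ _ _ _ _) _ => //.
  - by move=> i; exact: digits_lt.
  - by move=> i; exact: digits_lt.
  apply: ler_prod => i _; rewrite !digitsE lexx andbT.
  by case: ifP => // _; rewrite divr_ge0// ltW.
rewrite -(bigA_distr_bigA (fun i j => if v i == j then 1 else 8 / nu)).
rewrite -[X in 9 ^+ X]card_ord -prodr_const; apply: ler_prod => i _.
apply/andP; split.
  by apply: sumr_ge0 => j _; case: ifP => // _; rewrite divr_ge0// ltW.
rewrite (bigD1 (v i))//= eqxx.
apply: (@le_trans _ _ (1 + \sum_(j < M) 8 / nu)).
  rewrite lerD2l [leRHS](bigD1 (v i))//= -[leLHS]add0r; apply: lerD.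
    by rewrite divr_ge0// ltW.
  by apply: ler_sum => j; rewrite eq_sym => /negbTE ->.
rewrite sumr_const card_ord -[8 / nu *+ _]mulr_natr.
have : M%:R / nu <= 1 by rewrite ler_pdivrMr// mul1r.
by move=> ?; rewrite mulrAC -mulrA; lra.
Qed.

Lemma sign_valued_bmeas (d : nat) (f : vec R d -> R) : sign_valued f -> bmeas f.
Proof.
move=> [mf fv]; split=> //; exists 1 => x.
by case: (fv x) => ->; rewrite ?normrN normr1.
Qed.

Lemma sign_valued_halfspace (d : nat) (w : vec R d) (theta : R) :
  sign_valued (halfspace w theta).
Proof.
split; last by move=> x; exact: sign_val.
by case: (bmeas_sign_lin w theta).
Qed.

(** For values 1 and -1, the indicator of [f x != h x] is [(1 - f x * h x) / 2]. *)
Lemma disagreementE (d : nat) (f h : vec R d -> R) :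
  sign_valued f -> sign_valued h ->
  disagreement f h = (1 - \int[gaussian R d]_x (f x * h x)) / 2.
Proof.
move=> sf sh; have bf := sign_valued_bmeas sf; have bh := sign_valued_bmeas sh.
have b1 : bmeas (fun _ : vec R d => 1 : R) by exact: bmeas_cst.
have mA : measurable [set x | f x != h x].
  rewrite (_ : [set x | _] = (fun x => f x * h x) @^-1` [set -1]); last first.
    apply/seteqP; split=> x /=; case: sf => _ /(_ x); case: sh => _ /(_ x).
      by move=> [->|->] [->|->]; rewrite ?eqxx// ?mulr1 ?mul1r.
    move=> [->|->] [->|->]; rewrite ?mulrNN ?mulr1 ?mul1r => E;
      by apply/eqP => E'; lra.
  rewrite -[X in measurable X]setTI.
  have [mfh _] := bmeasM bf bh; exact: mfh.
rewrite /disagreement -mean_indic//.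
have -> : (1 - \int[gaussian R d]_x (f x * h x)) / 2 =
    \int[gaussian R d]_x (2^-1 * (1 - f x * h x)).
  rewrite meanZ; last by apply: bmeasB => //; exact: bmeasM.
  by rewrite meanB// ?mean_cst 1?mulrC//; exact: bmeasM.
apply: eq_Rintegral => x _; rewrite indicE.
case: (boolP (x \in _)) => [|/negP]; rewrite inE/=.
  by case: sf => _ /(_ x) [->|->]; case: sh => _ /(_ x) [->|->];
    rewrite ?eqxx// => _ /=; lra.
move/negP; rewrite negbK => /eqP ->.
by case: sh => _ /(_ x) [->|->]; rewrite /=; lra.
Qed.

Lemma dist_halfspaces_le (d : nat) (f : vec R d -> R) (w : vec R d) (theta : R) :
  dist_halfspaces f <= disagreement f (halfspace w theta).
Proof.
apply: ge_inf; last by exists (halfspace w theta) => //; exists w, theta.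
by exists 0 => _ [h _ <-]; exact: fine_ge0.
Qed.

Lemma dist_halfspaces_ge (d : nat) (f : vec R d -> R) (a : R) :
  (forall w theta, a <= disagreement f (halfspace w theta)) ->
  a <= dist_halfspaces f.
Proof.
move=> H; apply: lb_le_inf; last by move=> _ [_ [w [theta ->]] <-].
exists (disagreement f (halfspace [tuple 0 | i < d] 0)).
by exists (halfspace [tuple 0 | i < d] 0) => //; exists [tuple 0 | i < d], 0.
Qed.

Lemma dist_hard_ge (nu : R) (M d : nat) (v : {ffun 'I_d./2 -> 'I_M}) :
  (0 < d)%N -> 0 < nu -> (0 < M)%N ->
  (1 - 8 / (nu * M%:R)) / 2 <= dist_halfspaces (hard nu v).
Proof.
move=> d0 nu0 M0; apply: dist_halfspaces_ge => w theta.
rewrite disagreementE; [|exact: sign_valued_hard|exact: sign_valued_halfspace].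
rewrite ler_pM2r ?invr_gt0// lerD2l lerN2; apply: le_trans (ler_norm _) _.
rewrite hardE -/(hcorr _ _ _ _).
by case: d d0 v w => // n _ v w; exact: hcorr_freq_le.
Qed.

(** The signs of the halfspaces [h1] and [h2] add up to 2 on the slab, where the wave is 1, and
    cancel outside it. Their correlations with the wave thus sum to [2 * slab w 0], and one of them
    is at least half of that. *)
Lemma dist_hard_le (nu : R) (M d : nat) (v : {ffun 'I_d./2 -> 'I_M}) (b : R) :
  b <= slab (freq nu M (digits v) d) 0 ->
  dist_halfspaces (hard nu v) <= (1 - b) / 2.
Proof.
set w := freq nu M (digits v) d => bs.
pose w' : vec R d := [tuple - tnth w i | i < d].
have lw' x : lin w' x = - lin w x.
  by rewrite /lin -sumrN; apply: eq_bigr => i _; rewrite tnth_mktuple mulNr.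
pose h1 := halfspace w 0; pose h2 := halfspace w' 2^-1.
have bf := bmeas_hard nu v.
have b1 : bmeas h1 by exact: bmeas_sign_lin.
have b2 : bmeas h2 by exact: bmeas_sign_lin.
have bfh1 : bmeas (fun x => hard nu v x * h1 x) by exact: bmeasM.
have bfh2 : bmeas (fun x => hard nu v x * h2 x) by exact: bmeasM.
have E : \int[gaussian R d]_x (hard nu v x * h1 x) +
    \int[gaussian R d]_x (hard nu v x * h2 x) = 2 * slab w 0.
  rewrite -meanD// -meanZ; last exact: bmeas_slab_fun.
  apply: eq_Rintegral => x _; rewrite -mulrDr /h1 /h2 !halfspaceE lw' /hard -/w addr0.
  set l := lin w x; rewrite indicE /sign.
  case: (boolP (l \in _)) => [|/negP]; rewrite inE/= in_itv/=.
    move=> /andP[l0 l1]; rewrite l0 wave_unit; last by apply/andP; split; lra.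
    have -> : 0 <= - l + 2^-1 by lra.
    by rewrite mul1r mulr1.
  move=> nl; case: (leP 0 l) => l0; case: (leP 0 (- l + 2^-1)) => l1;
    try by rewrite ?subrr ?addNr ?mulr0.
    by case: nl; apply/andP; split; lra.
  by exfalso; lra.
have [B|B] := leP (slab w 0) (\int[gaussian R d]_x (hard nu v x * h1 x)).
  apply: le_trans (dist_halfspaces_le _ w 0) _.
  rewrite disagreementE; [|exact: sign_valued_hard|exact: sign_valued_halfspace].
  by rewrite ler_pM2r ?invr_gt0// lerD2l lerN2; exact: le_trans bs B.
apply: le_trans (dist_halfspaces_le _ w' 2^-1) _.
rewrite disagreementE; [|exact: sign_valued_hard|exact: sign_valued_halfspace].
rewrite ler_pM2r ?invr_gt0// lerD2l lerN2; apply: le_trans bs _.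
rewrite -/h2; move: E B; set x := Rintegral _ _ _; set y := Rintegral _ _ _.
by move=> ? ?; lra.
Qed.

End hard_functions.

(** * Few members of a nearly orthogonal family correlate with a given function *)

Section correlated_members.
Context (R : realType).

(** Let [G] be the sum of the correlated members, signed to correlate positively with [u]. Its
    correlation with [u] is at least [tau * #|S|] and its second moment at most [#|S| * D], so
    Cauchy-Schwarz bounds [#|S|]. *)
Lemma card_correlated_le (disp : measure_display) (T : measurableType disp)
    (P : probability T R) (I : finType) (F : I -> T -> R) (u : T -> R)
    (D tau : R) :
  (forall v, bmeas (F v)) -> bmeas u -> (forall x, `|u x| <= 1) ->
  (forall v, \sum_w `|\int[P]_x (F v x * F w x)| <= D) -> 0 <= D -> 0 < tau ->
  #|[set v | tau < `|\int[P]_x (F v x * u x)|]%SET|%:R <= D / tau ^+ 2.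
Proof.
move=> bF bu u1 rowD D0 tau0; set S := [set v | _]%SET.
pose c v : R := if v \in S then Num.sg (\int[P]_x (F v x * u x)) else 0.
have c1 v : `|c v| <= (v \in S)%:R.
  by rewrite /c; case: ifP => _; rewrite ?normr0// normr_sg lern1 leq_b1.
pose G x := \sum_v c v * F v x.
have bcF v : bmeas (fun x => c v * F v x) by exact: bmeasZ.
have bG : bmeas G by exact: bmeas_sum.
have cardS : \sum_v (v \in S)%:R = #|S|%:R :> R.
  by rewrite -natr_sum -sum1_card -big_mkcond.
have GG : \int[P]_x (G x * G x) <= #|S|%:R * D.
  have bFw v w : bmeas (fun x => c v * c w * (F v x * F w x)).
    by apply: bmeasZ; exact: bmeasM.
  have -> : \int[P]_x (G x * G x) =
      \sum_v \sum_w c v * c w * \int[P]_x (F v x * F w x).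
    under eq_Rintegral => x _.
      rewrite /G mulr_suml; under eq_bigr => v _.
        rewrite mulr_sumr; under eq_bigr => w _ do rewrite mulrACA.
        over.
      over.
    rewrite mean_sum; last by move=> v; exact: bmeas_sum.
    apply: eq_bigr => v _; rewrite mean_sum//; apply: eq_bigr => w _.
    by rewrite meanZ//; exact: bmeasM.
  rewrite -cardS mulr_suml; apply: ler_sum => v _.
  apply: (@le_trans _ _ ((v \in S)%:R * \sum_w `|\int[P]_x (F v x * F w x)|)).
    rewrite mulr_sumr; apply: ler_sum => w _.
    apply: le_trans (ler_norm _) _; rewrite !normrM -mulrA ler_pM//.
    by rewrite ler_piMl// (le_trans (c1 w))// lern1 leq_b1.
  by rewrite ler_wpM2l.
have Gu : tau * #|S|%:R <= \int[P]_x (G x * u x).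
  have bFu v : bmeas (fun x => c v * (F v x * u x)).
    by apply: bmeasZ; exact: bmeasM.
  have -> : \int[P]_x (G x * u x) = \sum_v c v * \int[P]_x (F v x * u x).
    under eq_Rintegral => x _.
      rewrite /G mulr_suml; under eq_bigr => v _ do rewrite -mulrA.
      over.
    rewrite mean_sum//; apply: eq_bigr => v _.
    by rewrite meanZ//; exact: bmeasM.
  rewrite -cardS mulr_sumr; apply: ler_sum => v _; rewrite /c.
  case: ifP => vS; last by rewrite mulr0 mul0r.
  rewrite mulr1 -normrEsg; move: vS; rewrite inE; exact: ltW.
have uu : \int[P]_x (u x * u x) <= 1.
  rewrite -[leRHS](mean_cst P 1); apply: ler_mean; [exact: bmeasM|exact: bmeas_cst|].
  move=> x; apply: le_trans (ler_norm _) _; rewrite normrM -[leRHS]mulr1.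
  by rewrite ler_pM.
(* Cauchy-Schwarz in the form [0 <= E[(G - t u)^2]], where this [t] yields [t^2 <= #|S| * D]. *)
set t := tau * #|S|%:R in Gu.
have t0 : 0 <= t by rewrite mulr_ge0// ltW.
have : 0 <= \int[P]_x ((G x * G x - 2 * t * (G x * u x)) + t ^+ 2 * (u x * u x)).
  apply: Rintegral_ge0 => x _.
  by rewrite (_ : _ + _ = (G x - t * u x) ^+ 2) ?sqr_ge0//; ring.
have bGG : bmeas (fun x => G x * G x) by exact: bmeasM.
have bGu : bmeas (fun x => G x * u x) by exact: bmeasM.
have buu : bmeas (fun x => u x * u x) by exact: bmeasM.
rewrite meanD; [|apply: bmeasB => //; exact: bmeasZ|exact: bmeasZ].
rewrite meanB//; last exact: bmeasZ.
rewrite !meanZ//.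
move: GG Gu uu; set x := Rintegral _ _ _; set y := Rintegral _ _ _.
set z := Rintegral _ _ _ => GG Gu uu E.
have A1 : t * t <= t * y by exact: ler_wpM2l.
have A2 : t ^+ 2 * z <= t ^+ 2 by rewrite ler_piMr// sqr_ge0.
have A3 : t ^+ 2 <= #|S|%:R * D.
  by move: A1 A2 GG E; rewrite expr2 -mulrA; clear => ? ? ? ?; lra.
have [->|S0] := eqVneq #|S| 0%N; first by rewrite divr_ge0// sqr_ge0.
have S1 : 0 < #|S|%:R :> R by rewrite ltr0n lt0n.
rewrite ler_pdivlMr ?exprn_gt0// -(ler_pM2l S1).
by apply: le_trans A3; rewrite (_ : _ * _ = t ^+ 2)// /t; ring.
Qed.

End correlated_members.

(** * Answering queries as for random labels *)

Section null_oracle.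
Context (R : realType) (d : nat).
Implicit Types (q : sq_query R d) (f : vec R d -> R).

Lemma bmeas_query q (y : R) : -1 <= y <= 1 -> bmeas (fun x => q x y).
Proof.
move=> y1; split; last by exists 1 => x; rewrite ler_norml; exact: query_range.
apply: (@measurable_comp _ _ _ _ _ _ ([set: vec R d] `*` [set` `[(-1 : R), 1]])
  (fun p : vec R d * measurableTypeR R => q p.1 p.2) _
  (fun x => (x, y) : vec R d * measurableTypeR R)).
- by apply: measurableX.
- by move=> _ [x _ <-]; split => //=; rewrite in_itv.
- exact: query_measurable.
- exact: measurable_pair2.
Qed.

(** The mean of [q] when the label is a fair coin independent of [x]. *)
Definition null_answer q : R :=
  \int[gaussian R d]_x (2^-1 * (q x 1 + q x (-1))).

Definition query_diff q (x : vec R d) : R := 2^-1 * (q x 1 - q x (-1)).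

Let m1 : -1 <= (1 : R) <= 1. Proof. by apply/andP; split; lra. Qed.
Let mN1 : -1 <= (-1 : R) <= 1. Proof. by apply/andP; split; lra. Qed.

Lemma bmeas_query_diff q : bmeas (query_diff q).
Proof. by apply: bmeasZ; apply: bmeasB; exact: bmeas_query. Qed.

Lemma norm_query_diff q x : `|query_diff q x| <= 1.
Proof.
have /andP[? ?] := query_range q x m1; have /andP[? ?] := query_range q x mN1.
by rewrite /query_diff ler_norml; apply/andP; split; lra.
Qed.

(** A function of a label 1 or -1 is affine in it, so a query reveals [f] only through its
    correlation with [query_diff q]. *)
Lemma query_meanE q f : sign_valued f ->
  query_mean f q = null_answer q + \int[gaussian R d]_x (f x * query_diff q x).
Proof.
move=> sf; have bf := sign_valued_bmeas sf.
rewrite -meanD; first last.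
- by apply: bmeasM => //; exact: bmeas_query_diff.
- by apply: bmeasZ; apply: bmeasD; exact: bmeas_query.
apply: eq_Rintegral => x _; rewrite /query_diff.
by case: sf => _ /(_ x) [->|->]; field.
Qed.

Definition fools (tau : R) f q : bool := `|query_mean f q - null_answer q| <= tau.

(** Conceals [f] whenever the tolerance permits and otherwise answers exactly, so it is legitimate
    for [f]. *)
Definition fooling_oracle (tau : R) f : oracle R d := fun _ q =>
  if fools tau f q then null_answer q else query_mean f q.

Definition null_oracle : oracle R d := fun _ q => null_answer q.

Lemma STAT_fooling_oracle (tau : R) f : 0 <= tau -> STAT tau f (fooling_oracle tau f).
Proof.
by move=> tau0 h q; rewrite /fooling_oracle; case: ifP => //; rewrite subrr normr0.
Qed.

Fixpoint null_queries (A : sq_alg R d) : seq (sq_query R d) :=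
  match A with
  | Output _ => [::]
  | Ask q k => q :: null_queries (k (null_answer q))
  end.

Lemma size_sq_exec (O : oracle R d) h (A : sq_alg R d) :
  (size h <= size (sq_exec O h A).2)%N.
Proof.
elim: A h => [a|q k IH] h //=.
by apply: leq_trans (IH _ _); rewrite size_rcons.
Qed.

(** As long as queries are fooled, the run on [f] follows the run on null answers; so either that
    run stops in time or [n] queries are spent. *)
Lemma sq_exec_fooled (tau : R) f (A : sq_alg R d) h n :
  all (fools tau f) (take n (null_queries A)) ->
  sq_exec (fooling_oracle tau f) h A = sq_exec null_oracle h A \/
  (size h + n <= size (sq_exec (fooling_oracle tau f) h A).2)%N.
Proof.
elim: A h n => [a|q k IH] h [|n] /=; try by left.
  by right; rewrite addn0; apply: leq_trans (size_sq_exec _ _ _); rewrite size_rcons.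
move=> /andP[fq al].
have -> : fooling_oracle tau f h q = null_answer q by rewrite /fooling_oracle fq.
have [->|] := IH _ (rcons h q) _ al; first by left.
by rewrite size_rcons addSnnS; right.
Qed.

End null_oracle.

(** * From two indistinguishable families to a query bound *)

Section lower_bound.
Context (R : realType).

Lemma card_has_le (I : finType) (Q : Type) (p : Q -> I -> bool) (b : R) (l : seq Q) :
  (forall q, #|[set v | p q v]%SET|%:R <= b) ->
  #|[set v | has (fun q => p q v) l]%SET|%:R <= (size l)%:R * b.
Proof.
move=> pb; elim: l => [|q l IH].
  rewrite (_ : [set v | _]%SET = finset.set0) ?cards0 /= ?mul0r//.
rewrite (_ : [set v | _]%SET =
  ([set v | p q v] :|: [set v | has (fun q => p q v) l])%SET); last first.
  by apply/finset.setP => v; rewrite !inE.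
rewrite mulrSr mulrDl mul1r addrC.
apply: le_trans (lerD (pb q) IH).
by rewrite -natrD ler_nat cardsU leq_subr.
Qed.

(** For a fixed seed, all members not exposed by the queries of the null run receive the same
    output, which by the gap cannot be right for both families. Averaging over seeds the number of
    members answered correctly gives twice [51 / 100] of [#|I|] on one side and [#|I|] plus the
    exposed members on the other. *)
Lemma sq_dist_lower_bound (d : nat) (I : finType) (F1 F2 : I -> vec R d -> R)
    (D alpha1 alpha2 tau eps : R)
    (disp : measure_display) (Omega : measurableType disp)
    (P : probability Omega R) (A : Omega -> sq_alg R d) (m : nat) :
  (forall v, sign_valued (F1 v)) -> (forall v, sign_valued (F2 v)) ->
  (forall v, \sum_w `|\int[gaussian R d]_x (F1 v x * F1 w x)| <= D) ->
  (forall v, \sum_w `|\int[gaussian R d]_x (F2 v x * F2 w x)| <= D) ->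
  (forall v, dist_halfspaces (F1 v) <= alpha1) ->
  (forall v, alpha2 <= dist_halfspaces (F2 v)) ->
  alpha1 + 2 * eps < alpha2 -> 0 <= D -> 0 < tau ->
  sq_dist_approx P A tau eps (51 / 100) -> sq_cost_le A tau m ->
  2 / 100 * #|I|%:R <= m.+1%:R * (D / tau ^+ 2).
Proof.
move=> s1 s2 r1 r2 d1 d2 gap D0 tau0 approx cost.
pose b := m.+1%:R * (D / tau ^+ 2).
have Dt0 : 0 <= D / tau ^+ 2 by rewrite divr_ge0// sqr_ge0.
(* One query beyond the cost bound [m] is inspected, so that the second alternative of
   [sq_exec_fooled] contradicts the bound. *)
pose bad (F : I -> vec R d -> R) s : {set I} :=
  [set v | has (fun q => ~~ fools tau (F v) q) (take m.+1 (null_queries (A s)))]%SET.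
have bad_le F s : (forall v, sign_valued (F v)) ->
    (forall v, \sum_w `|\int[gaussian R d]_x (F v x * F w x)| <= D) ->
    #|bad F s|%:R <= b.
  move=> sF rF; apply: le_trans (card_has_le (b := D / tau ^+ 2) _ _) _.
    move=> q; rewrite (_ : [set v | _]%SET =
        [set v | tau < `|\int[gaussian R d]_x (F v x * query_diff q x)|]%SET).
      apply: card_correlated_le => //.
      - by move=> v; exact: sign_valued_bmeas.
      - exact: bmeas_query_diff.
      - by move=> x; exact: norm_query_diff.
    by apply/finset.setP => v; rewrite !inE /fools -ltNge query_meanE// addrC addKr.
  by rewrite ler_wpM2r// ler_nat size_take_min geq_minl.
pose out s := (sq_exec (@null_oracle R d) [::] (A s)).1.
have ex (F : I -> vec R d -> R) : (forall v, sign_valued (F v)) ->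
    exists E : I -> set Omega, (forall v, [/\ measurable (E v),
      (51 / 100 <= fine (P (E v))) & forall s, E v s -> v \notin bad F s ->
      `|dist_halfspaces (F v) - out s| <= eps]).
  move=> sF; have H v : exists E : set Omega, [/\ measurable E,
      (51 / 100 <= fine (P E)) & forall s, E s -> v \notin bad F s ->
      `|dist_halfspaces (F v) - out s| <= eps].
    have ST := STAT_fooling_oracle (F v) (ltW tau0).
    have [E [mE PE sE]] := approx _ (sF v) _ ST.
    exists E; split => //.
      by rewrite -lee_fin fineK// fin_num_measure.
    move=> s /sE /= Es vb.
    have al : all (fools tau (F v)) (take m.+1 (null_queries (A s))).
      move: vb; rewrite inE -all_predC; apply: sub_all => q /=.
      by rewrite negbK.
    have [eq|] := sq_exec_fooled [::] al.
      by move: Es; rewrite /sq_output eq.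
    have := cost _ (sF v) _ ST s; rewrite /sq_cost /= add0n => c1 c2.
    by have := leq_trans c2 c1; rewrite ltnn.
  by have [E HE] := choice H; exists E.
have [E1 HE1] := ex F1 s1; have [E2 HE2] := ex F2 s2.
pose cnt (E : I -> set Omega) s : R := \sum_v \1_(E v) s.
have cntE E s : cnt E s = #|[set v | s \in E v]%SET|%:R.
  rewrite /cnt -sum1_card natr_sum [RHS]big_mkcond/=.
  by apply: eq_bigr => v _; rewrite indicE inE; case: (_ \in _).
have cntI E s : cnt E s <= #|I|%:R by rewrite cntE ler_nat max_card.
(* If the null output is right for one unexposed member of [F1], then every success on [F2] is on an
   exposed member; otherwise every success on [F1] is. *)
have cnt_le s : cnt E1 s + cnt E2 s <= #|I|%:R + b.
  have [[v Ev vb]|none] := pselect (exists2 v, s \in E1 v & v \notin bad F1 s).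
    apply: lerD => //; rewrite cntE; apply: le_trans (bad_le F2 s s2 r2).
    rewrite ler_nat subset_leq_card//; apply/fintype.subsetP => w; rewrite inE => Ew.
    apply/negP => /negP wb.
    have [_ _ /(_ s)] := HE1 v; rewrite inE in Ev => /(_ Ev vb) X1.
    have [_ _ /(_ s)] := HE2 w; rewrite inE in Ew => /(_ Ew wb) X2.
    move: X1 X2; rewrite !ler_norml => /andP[X1 _] /andP[_ X2].
    have := d1 v; have := d2 w; lra.
  rewrite addrC; apply: lerD => //; rewrite cntE; apply: le_trans (bad_le F1 s s1 r1).
  rewrite ler_nat subset_leq_card//; apply/fintype.subsetP => v; rewrite inE => Ev.
  by apply: contrapT => /negP vb; apply: none; exists v.
have bE (E : I -> set Omega) : (forall v, measurable (E v)) -> bmeas (cnt E).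
  by move=> mE; apply: bmeas_sum => v; exact: bmeas_indic.
have mE1 v : measurable (E1 v) by case: (HE1 v).
have mE2 v : measurable (E2 v) by case: (HE2 v).
have meanE (E : I -> set Omega) : (forall v, measurable (E v)) ->
    (forall v, 51 / 100 <= fine (P (E v))) -> 51 / 100 * #|I|%:R <= \int[P]_s cnt E s.
  move=> mE pE; rewrite /cnt mean_sum; last by move=> v; exact: bmeas_indic.
  rewrite -sum1_card natr_sum mulr_sumr; apply: ler_sum => v _.
  by rewrite mulr1 mean_indic.
have M1 := meanE E1 mE1 (fun v => let: And3 _ h _ := HE1 v in h).
have M2 := meanE E2 mE2 (fun v => let: And3 _ h _ := HE2 v in h).
have : \int[P]_s (cnt E1 s + cnt E2 s) <= #|I|%:R + b.
  rewrite -[leRHS](mean_cst P (#|I|%:R + b)).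
  by apply: ler_mean => //; [apply: bmeasD; exact: bE|exact: bmeas_cst].
rewrite meanD; [|exact: bE..].
rewrite -/b; move: M1 M2; clear.
by set x := Rintegral _ _ _; set y := Rintegral _ _ _ => ? ? ?; lra.
Qed.

End lower_bound.

(** * Comparison of exponents *)

Section asymptotics.
Context (R : realType).

Lemma leq_half3 (d : nat) : (2 <= d)%N -> (d <= d./2 * 3)%N.
Proof.
move=> d2; have k1 : (0 < d./2)%N by rewrite half_gt0.
rewrite mulnC 2!mulSn mul1n addnn -[X in (X <= _)%N]odd_double_half leq_add2r.
exact: leq_trans (leq_b1 _) k1.
Qed.

(** The exponents of [z] are [d / 6] and [k / 2]. *)
Lemma powR_sqrt_exp (z : R) (d k : nat) : 1 <= z -> (d <= k * 3)%N ->
  (z `^ (24^-1 * d%:R)) ^+ 4 <= Num.sqrt z ^+ k.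
Proof.
move=> z1 dk; have z0 : 0 <= z by lra.
rewrite -powR12_sqrt// -!powR_mulrn ?powR_ge0// -!powRrM ler_powR//.
have : d%:R <= k%:R * 3 :> R by rewrite -natrM ler_nat.
by move=> ?; lra.
Qed.

(** As [d >= 2], the exponent is at least [1 / 12]. This absorbs constants depending on [d] once
    [eps] is small. *)
Lemma powR_ge_of_exp (z b : R) (d : nat) : 1 <= z -> 0 <= b -> b ^+ 12 <= z ->
  (2 <= d)%N -> b <= z `^ (24^-1 * d%:R).
Proof.
move=> z1 b0 bz d2; have z0 : 0 <= z by lra.
have e : b = (b ^+ 12) `^ 12^-1.
  by rewrite -powR_mulrn// -powRrM mulfV// powRr1.
rewrite e; apply: (@le_trans _ _ (z `^ 12^-1)).
  by apply: ge0_ler_powR; rewrite ?nnegrE ?invr_ge0 ?exprn_ge0.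
rewrite ler_powR//; have : 2 <= d%:R :> R by rewrite ler_nat.
by move=> ?; lra.
Qed.

Lemma powR_inv_mul (eps r : R) : 0 < eps -> eps `^ r = ((1 / eps) `^ r)^-1.
Proof.
move=> e0; have E : (1 / eps) `^ r * eps `^ r = 1.
  by rewrite -powRM ?divr_ge0 ?(ltW e0)// mul1r mulVf ?gt_eqF// powR1.
by rewrite -[RHS]mulr1 -[X in _ * X]E mulKf// gt_eqF// powR_gt0// divr_gt0.
Qed.

End asymptotics.

(** * Choice of the parameters and conclusion *)

Theorem theorem5p2 (R : realType) :
  exists2 c : R, 0 < c &
  forall d : nat, (2 <= d)%N ->
  exists2 eps0 : R, 0 < eps0 &
  forall eps : R, 0 < eps -> eps < eps0 ->
  forall (disp : measure_display) (Omega : measurableType disp)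
    (P : probability Omega R) (A : Omega -> sq_alg R d) (m : nat),
  let tau := eps `^ (c * d%:R) in
  sq_dist_approx P A tau eps (51 / 100) ->
  sq_cost_le A tau m ->
  (1 / eps) `^ (c * d%:R) <= m%:R.
Proof.
(* For [X = (1 / eps) ^ (d / 24)], the family has at least a constant times [X ^ 4] members. Two
   powers are lost to [tau ^ -2], a third pays for the constants, and one remains. *)
exists 24^-1; first by rewrite invr_gt0.
move=> d d2; have d0 : (0 < d)%N by exact: ltnW.
have [kappa k0 slabP] := slab_freq_ge d.-1 (lexx (0 : R)).
rewrite prednK// in slabP.
pose a : R := Num.sqrt kappa / 8; have a0 : 0 < a by rewrite divr_gt0// sqrtr_gt0.
(* Here [a] satisfies [a * sqrt (1 / eps) <= M], 9 comes from the row sums and [2 / 100] from the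
   success probability. *)
pose C : R := 2 / 100 * (a / 9) ^+ d./2.
have C0 : 0 < C by rewrite mulr_gt0// exprn_gt0// divr_gt0.
(* The three bounds ensure [1 <= 1 / eps], [M >= 1] and [C * X >= 2], respectively. *)
exists (Num.min 1 (Num.min (kappa / 16) ((C / 2) ^+ 12))).
  by rewrite !lt_min ltr01 divr_gt0// exprn_gt0// divr_gt0.
move=> eps e0; rewrite !lt_min => /and3P[e1 ek eC] disp Omega P A m tau approx cost.
pose z : R := 1 / eps; have z1 : 1 <= z by rewrite ler_pdivlMr// mul1r ltW.
have z0 : 0 < z by lra.
pose X := z `^ (24^-1 * d%:R).
have X0 : 0 < X by exact: powR_gt0.
have tauE : tau = X^-1 by exact: powR_inv_mul.
have CX : 2 / C <= X.
  apply: powR_ge_of_exp => //; first by rewrite divr_ge0// ltW.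
  rewrite ler_pdivlMr//; move: eC => /ltW.
  rewrite -(ler_pM2l (_ : 0 < (2 / C) ^+ 12)) ?exprn_gt0 ?divr_gt0// -exprMn.
  by rewrite mulrA divfK ?gt_eqF// mulfV// expr1n.
pose y := Num.sqrt (kappa / (16 * eps)).
have ke0 : 0 < kappa / (16 * eps) by rewrite divr_gt0// mulr_gt0.
have y1 : 1 <= y.
  rewrite -sqrtr1 ler_wsqrtr// ler_pdivlMr ?mulr_gt0// mul1r.
  by move: ek; rewrite ltr_pdivlMr// mulrC => /ltW.
pose M := Num.truncn y.
have y0 : 0 <= y by lra.
have /andP[My yM] : M%:R <= y < M.+1%:R by exact: truncn_itv.
have M0 : (0 < M)%N by rewrite truncn_gt0.
have M1 : 1 <= M%:R :> R by rewrite ler1n.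
have yM2 : y <= 2 * M%:R by move: yM; rewrite -natr1; lra.
have y2 : y ^+ 2 = kappa / (16 * eps) by rewrite sqr_sqrtr// ltW.
have MM : M%:R * M%:R <= kappa / (16 * eps) by rewrite -y2 expr2 ler_pM.
have MM0 : 0 < M%:R * M%:R :> R by apply: mulr_gt0; lra.
(* [L >= 16 / kappa] makes the largest correlation in the second family at most half the guaranteed
   one in the first; [L >= 1] keeps the frequency [L * M] above [M] for the row sums. *)
pose L : R := Num.max 1 (16 / kappa).
have L1 : 1 <= L by rewrite le_max lexx.
have L2 : 16 / kappa <= L by rewrite le_max lexx orbT.
have L0 : 0 < L by lra.
pose F1 (v : {ffun 'I_d./2 -> 'I_M}) := hard (M%:R : R) v.
pose F2 (v : {ffun 'I_d./2 -> 'I_M}) := hard (L * M%:R : R) v.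
pose alpha1 := (1 - kappa / (M%:R * M%:R)) / 2.
pose alpha2 := (1 - 8 / (L * M%:R * M%:R)) / 2.
have LM : M%:R <= L * M%:R by rewrite ler_peMl.
(* The difference is at least [kappa / (4 * M ^ 2)], which the choice of [M] makes at least
   [4 * eps]. *)
have gap : alpha1 + 2 * eps < alpha2.
  have A1 : 8 / (L * M%:R * M%:R) <= kappa / (M%:R * M%:R) / 2.
    rewrite -[L * _ * _]mulrA invfM mulrA [leRHS]mulrAC ler_pM2r ?invr_gt0//.
    rewrite ler_pdivrMr//; move: L2; rewrite ler_pdivrMr//; lra.
  have A2 : 16 * eps <= kappa / (M%:R * M%:R).
    rewrite ler_pdivlMr//; move: MM; rewrite ler_pdivlMr ?mulr_gt0//; lra.
  rewrite /alpha1 /alpha2; move: A1 A2.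
  move: (kappa / (M%:R * M%:R)) (8 / (L * M%:R * M%:R)); clear -e0 => u w; lra.
have tau0 : 0 < tau by rewrite tauE invr_gt0.
have D0 : 0 <= 9 ^+ d./2 :> R by rewrite exprn_ge0.
have main : 2 / 100 * #|{ffun 'I_d./2 -> 'I_M}|%:R <=
    m.+1%:R * (9 ^+ d./2 / tau ^+ 2).
  apply: (sq_dist_lower_bound (F1 := F1) (F2 := F2)
    _ _ _ _ _ _ gap D0 tau0 approx cost).
  - by move=> v; exact: sign_valued_hard.
  - by move=> v; exact: sign_valued_hard.
  - by move=> v; exact: hard_row_sum.
  - by move=> v; exact: hard_row_sum.
  - move=> v; apply: dist_hard_le; apply: slabP => //; first lra.
    + by move=> i; exact: digits_lt.
    + by rewrite mulr_ege1.
    + by rewrite normr0 mul0r.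
  - by move=> v; apply: dist_hard_ge => //; rewrite mulr_gt0//; lra.
rewrite card_ffun !card_ord natrX in main.
have aM : a * Num.sqrt z <= M%:R.
  suff -> : a * Num.sqrt z = y / 2 by rewrite ler_pdivrMr// mulrC.
  have -> : y = Num.sqrt (kappa * z / 4 ^+ 2).
    by congr Num.sqrt; rewrite /z; field; rewrite gt_eqF.
  have kz0 : 0 <= kappa * z by rewrite mulr_ge0 ?(ltW k0) ?(ltW z0).
  rewrite (sqrtrM _ kz0) (sqrtrM z (ltW k0)) sqrtrV ?exprn_ge0// sqrtr_sqr ger0_norm//.
  by rewrite /a; field.
have X4 : X ^+ 4 <= Num.sqrt z ^+ d./2 by apply: powR_sqrt_exp => //; exact: leq_half3.
have K : C * X ^+ 2 <= m.+1%:R.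
  have E1 : a ^+ d./2 * X ^+ 4 <= M%:R ^+ d./2.
    apply: (@le_trans _ _ ((a * Num.sqrt z) ^+ d./2)).
      by rewrite [leRHS]exprMn ler_wpM2l// exprn_ge0// ltW.
    by rewrite lerXn2r ?nnegrE ?mulr_ge0 ?sqrtr_ge0 ?(ltW a0).
  have X2 : 0 < X ^+ 2 by rewrite exprn_gt0.
  rewrite -(ler_pM2r X2).
  have N9 : 0 < 9 ^+ d./2 :> R by rewrite exprn_gt0.
  rewrite -(ler_pM2r N9).
  move: main; rewrite tauE exprVn invrK => main.
  have -> : m.+1%:R * X ^+ 2 * 9 ^+ d./2 = m.+1%:R * (9 ^+ d./2 * X ^+ 2) by ring.
  apply: le_trans main; rewrite /C.
  have -> : 2 / 100 * (a / 9) ^+ d./2 * X ^+ 2 * X ^+ 2 * 9 ^+ d./2 =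
      2 / 100 * (a ^+ d./2 * X ^+ 4).
    by rewrite expr_div_n; field; rewrite gt_eqF.
  by rewrite ler_wpM2l// divr_ge0.
rewrite -/z -/X.
have CX2 : 2 <= C * X by move: CX; rewrite ler_pdivrMr// mulrC.
(* This absorbs the extra query: [2 * X <= m + 1] then gives [X <= m]. *)
have X1 : 1 <= X.
  rewrite /X -[leLHS](powRr0 z) ler_powR// mulr_ge0// invr_ge0//.
have : 2 * X <= C * X ^+ 2 by rewrite expr2 mulrA ler_pM2r.
move: K; rewrite -natr1; lra.
Qed.
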